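(* Consider a sequence of experiments indexed by the sample size $n$ in which treatment is assigned by a Bernoulli design for each $n$. The variance estimator $\widehat{\mathrm{Var}}_{MAX}(\hat\tau_{HT})=d_{\max}\,\widehat{\mathrm{Var}}_{BER}(\hat\tau_{HT})$ is asymptotically conservative if either: 1. the regularity conditions (Assumption R in the context) hold with $q\ge4$ and $d_{\max}=o\big(n^{1/2}d_{\mathrm{avg}}^{1/2}\big)$; or 2. the regularity conditions (Assumption R) hold with $q\ge 4$, $d_{\mathrm{avg}}=o(n)$, and $\tau_{MSQ}=\Omega(1)$ (i.e. $\liminf_{n\to\infty}\tau_{MSQ}>0$).
   Context: Setting. For each sample size $n$ there are units $U=\{1,\dots,n\}$ and arbitrary potential outcome functions $y_i:\{0,1\}^n\to\mathbb R$, $i\in U$. For $\mathbf z\in\{0,1\}^n$, $\mathbf z_{-i}$ is $\mathbf z$ with its $i$th entry deleted, and $y_i(\mathbf z)$ is also written $y_i(z_i;\mathbf z_{-i})$. An experimental design is the probability distribution of a random vector $\mathbf Z=(Z_1,\dots,Z_n)\in\{0,1\}^n$; it is the only source of randomness. Write $Y_i=y_i(\mathbf Z)$ and $p_i=\Pr(Z_i=1)$. All objects depend on $n$, with no relation assumed between different $n$; asymptotics are as $n\to\infty$. Assumption R (regularity conditions). There are constants $k<\infty$, $q\ge 2$, $s\ge 1$ such that for all $n$ and all $i\in U$: $k^{-1}\le \Pr(Z_i=1)\le 1-k^{-1}$; $E[|Y_i|^q]\le k^q$; and $E[|y_i(z;\mathbf Z_{-i})|^s]\le k^s$ for $z\in\{0,1\}$.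 Bernoulli design: $\Pr(\mathbf Z=\mathbf z)=\prod_{i=1}^n p_i^{z_i}(1-p_i)^{1-z_i}$. Interference. $I_{ij}=1$ if $i=j$ or if $y_j(\mathbf z)\ne y_j(\mathbf z')$ for some $\mathbf z,\mathbf z'\in\{0,1\}^n$ with $\mathbf z_{-i}=\mathbf z'_{-i}$; otherwise $I_{ij}=0$. $d_{ij}=1$ if $I_{\ell i}I_{\ell j}=1$ for some $\ell\in U$, else $d_{ij}=0$; $d_i=\sum_{j=1}^n d_{ij}$; $d_{\mathrm{avg}}=n^{-1}\sum_{i=1}^n d_i$; $d_{\max}=\max_{i\in U}d_i$. $\tau_i(\mathbf z_{-i})=y_i(1;\mathbf z_{-i})-y_i(0;\mathbf z_{-i})$ and $\tau_{MSQ}=\frac1n\sum_{i=1}^n\big(E[\tau_i(\mathbf Z_{-i})]\big)^2$. Estimators: $\hat\tau_{HT}=\frac1n\sum_i \frac{Z_iY_i}{p_i}-\frac1n\sum_i\frac{(1-Z_i)Y_i}{1-p_i}$ and $\widehat{\mathrm{Var}}_{BER}(\hat\tau_{HT})=\frac1{n^2}\sum_i\frac{Z_iY_i^2}{p_i^2}+\frac1{n^2}\sum_i\frac{(1-Z_i)Y_i^2}{(1-p_i)^2}$. A variance estimator $\hat V$ is asymptotically conservative (with respect to the variance of $\hat\tau_{HT}$) if $$\lim_{\varepsilon\to0^+}\lim_{n\to\infty}\Pr\Big(n\,d_{\mathrm{avg}}^{-1}\big[\hat V-\mathrm{Var}(\hat\tau_{HT})\big]\le-\varepsilon\Big)=0.$$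 *)

(* Defs.v *)
From HB Require Import structures.
From mathcomp Require Import all_boot all_order all_algebra.
From mathcomp Require Import all_classical all_reals all_analysis.
Import Order.TTheory GRing.Theory Num.Theory.
Import numFieldNormedType.Exports.

Set Implicit Arguments.
Unset Strict Implicit.
Unset Printing Implicit Defensive.

Local Open Scope classical_set_scope.
Local Open Scope ring_scope.

Definition assignment (n : nat) := {ffun 'I_n -> bool}.

Definition assignment_but (n : nat) := {ffun 'I_n.-1 -> bool}.

Definition delete (n : nat) (i : 'I_n) (z : assignment n) : assignment_but n :=
  [ffun j => z (lift i j)].

Definition insert (n : nat) (i : 'I_n) (a : bool) (w : assignment_but n) :
    assignment n :=
  [ffun j => if unlift i j is Some j' then w j' else a].

Definition outcomes (R : realType) (n : nat) := 'I_n -> assignment n -> R.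

(* An experimental design is a probability mass function on {0,1}^n; the
   random vector Z is the identity on this finite sample space, so a random
   variable is just a function of the assignment. *)
Record design (R : realType) (n : nat) := Design {
  pmf :> assignment n -> R ;
  pmf_ge0 : forall z, 0 <= pmf z ;
  pmf_sum1 : \sum_z pmf z = 1 }.

Section OneExperiment.
Variables (R : realType) (n : nat).
Variables (P : design R n) (y : outcomes R n).

Definition Pr (A : pred (assignment n)) : R := \sum_(z | A z) P z.

Definition Ex (X : assignment n -> R) : R := \sum_z P z * X z.

Definition Var (X : assignment n -> R) : R :=
  Ex (fun z => (X z - Ex X) ^+ 2).

Definition prob1 (i : 'I_n) : R := Pr (fun z => z i).

Definition Bernoulli_design : Prop :=
  forall z, P z =
    \prod_(i < n) (prob1 i ^+ (z i) * (1 - prob1 i) ^+ (1 - z i)%N).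

(* [y_split i a w] is the potential outcome y_i(a; w). *)
Definition y_split (i : 'I_n) (a : bool) (w : assignment_but n) : R :=
  y i (insert i a w).

Definition interferes (i j : 'I_n) : bool :=
  (i == j) ||
  [exists z, exists z', (delete i z == delete i z') && (y j z != y j z')].

Definition dependent (i j : 'I_n) : bool :=
  [exists l, interferes l i && interferes l j].

Definition degree (i : 'I_n) : nat := \sum_(j < n) dependent i j.

Definition d_avg : R := n%:R^-1 * \sum_(i < n) (degree i)%:R.

Definition d_max : nat := \max_(i < n) degree i.

Definition tau (i : 'I_n) (w : assignment_but n) : R :=
  y_split i true w - y_split i false w.

Definition tau_MSQ : R :=
  n%:R^-1 * \sum_(i < n) (Ex (fun z => tau i (delete i z))) ^+ 2.

Definition tau_HT (z : assignment n) : R :=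
  n%:R^-1 * \sum_(i < n) (z i)%:R * y i z / prob1 i
  - n%:R^-1 * \sum_(i < n) (1 - (z i)%:R) * y i z / (1 - prob1 i).

Definition Var_BER (z : assignment n) : R :=
  (n%:R ^+ 2)^-1 * \sum_(i < n) (z i)%:R * y i z ^+ 2 / prob1 i ^+ 2
  + (n%:R ^+ 2)^-1 *
      \sum_(i < n) (1 - (z i)%:R) * y i z ^+ 2 / (1 - prob1 i) ^+ 2.

Definition Var_MAX (z : assignment n) : R := d_max%:R * Var_BER z.

End OneExperiment.

Section Asymptotics.
Variables (R : realType).
Variables (P : forall n, design R n) (y : forall n, outcomes R n).

Definition regularity_conditions (k q s : R) : Prop :=
  [/\ 0 < k, 2 <= q, 1 <= s &
   forall n (i : 'I_n),
    [/\ k^-1 <= prob1 (P n) i <= 1 - k^-1,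
        Ex (P n) (fun z => `|y i z| `^ q) <= k `^ q &
        forall a : bool,
          Ex (P n) (fun z => `|y_split (@y n) i a (delete i z)| `^ s)
            <= k `^ s]].

Definition nonconservative_prob (V : forall n, assignment n -> R)
    (eps : R) (n : nat) : R :=
  Pr (P n) (fun z =>
    n%:R * (d_avg (@y n))^-1 * (V n z - Var (P n) (tau_HT (P n) (@y n)))
      <= - eps).

(* The first conjunct says that the inner limit exists for each eps > 0, as
   [limn] is an arbitrary value on divergent sequences. *)
Definition asymptotically_conservative (V : forall n, assignment n -> R) :
    Prop :=
  (forall eps : R, 0 < eps -> cvgn (nonconservative_prob V eps)) /\
  limn (nonconservative_prob V eps) @[eps --> 0^'+] --> (0 : R).

End Asymptotics.

(* Main.v *)
(* Write tau_HT = n^-1 sum_i W_i with W_i = (Z_i / p_i - (1 - Z_i) / (1 - p_i)) Y_i.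
   Under a Bernoulli design W_i and W_j are independent when d_ij = 0, and
   E[W_i] = E[tau_i]. Bounding each remaining covariance by the average of the two
   variances gives Var(tau_HT) <= d_max n^-2 sum_i Var(W_i), so that, with
   T = n^-1 sum_i W_i^2,
     n / d_avg (Var_MAX - Var(tau_HT)) >= d_max / d_avg (T - E[T] + tau_MSQ).
   Fourth moments give Var(T) = O(d_avg / n), and Chebyshev's inequality is applied
   to T at distance eps d_avg / d_max below E[T] in case 1, and at distance
   liminf tau_MSQ, up to a constant, in case 2. *)
Require Import Defs.
From HB Require Import structures.
From mathcomp Require Import all_boot all_order all_algebra.
From mathcomp Require Import all_classical all_reals all_analysis.
From mathcomp Require Import ring lra.
Import Order.TTheory GRing.Theory Num.Theory.
Import numFieldNormedType.Exports.
Local Open Scope classical_set_scope.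
Local Open Scope ring_scope.

Set Implicit Arguments.
Unset Strict Implicit.
Unset Printing Implicit Defensive.

(** * Expectation and probability on a finite sample space *)

Lemma ExZ (R : realType) n (P : design R n) (c : R) X :
  Ex P (fun z => c * X z) = c * Ex P X.
Proof. by rewrite /Ex mulr_sumr; apply: eq_bigr => z _; rewrite mulrCA. Qed.

Lemma ExD (R : realType) n (P : design R n) X Y :
  Ex P (fun z => X z + Y z) = Ex P X + Ex P Y.
Proof. by rewrite /Ex -big_split; apply: eq_bigr => z _; rewrite mulrDr. Qed.

Lemma ExB (R : realType) n (P : design R n) X Y :
  Ex P (fun z => X z - Y z) = Ex P X - Ex P Y.
Proof. by rewrite /Ex -sumrB; apply: eq_bigr => z _; rewrite mulrBr. Qed.

Lemma Ex_cst (R : realType) n (P : design R n) (c : R) : Ex P (fun=> c) = c.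
Proof. by rewrite /Ex -mulr_suml pmf_sum1 mul1r. Qed.

Lemma Ex_sum (R : realType) n (P : design R n) (I : finType)
    (X : I -> assignment n -> R) :
  Ex P (fun z => \sum_i X i z) = \sum_i Ex P (X i).
Proof.
by rewrite exchange_big; apply: eq_bigr => z _; rewrite mulr_sumr.
Qed.

Lemma eq_Ex (R : realType) n (P : design R n) X Y : X =1 Y -> Ex P X = Ex P Y.
Proof. by move=> XY; apply: eq_bigr => z _; rewrite XY. Qed.

Lemma Ex_le (R : realType) n (P : design R n) X Y :
  (forall z, X z <= Y z) -> Ex P X <= Ex P Y.
Proof. by move=> XY; apply: ler_sum => z _; apply: ler_wpM2l; [exact: Defs.pmf_ge0|exact: XY]. Qed.

Lemma Ex_ge0 (R : realType) n (P : design R n) X :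
  (forall z, 0 <= X z) -> 0 <= Ex P X.
Proof. by move=> X0; apply: sumr_ge0 => z _; rewrite mulr_ge0 ?Defs.pmf_ge0. Qed.

Lemma Pr_le (R : realType) n (P : design R n) (A B : pred (assignment n)) :
  (forall z, A z -> B z) -> Pr P A <= Pr P B.
Proof.
move=> AB; rewrite /Pr [leLHS]big_mkcond [leRHS]big_mkcond; apply: ler_sum => z _.
by case: ifP => [/AB ->//|_]; case: ifP => // _; exact: Defs.pmf_ge0.
Qed.

Lemma Pr_ge0 (R : realType) n (P : design R n) (A : pred (assignment n)) :
  0 <= Pr P A.
Proof. by apply: sumr_ge0 => z _; exact: Defs.pmf_ge0. Qed.

(** On the event, the squared deviation is at least [c ^+ 2]; elsewhere the terms of the variance
    are nonnegative. *)
Lemma Chebyshev_lower (R : realType) n (P : design R n) X (c : R) : 0 < c ->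
  Pr P (fun z => X z - Ex P X <= - c) <= Var P X / c ^+ 2.
Proof.
move=> c0; rewrite ler_pdivlMr ?exprn_gt0// /Pr mulr_suml big_mkcond /=.
apply: ler_sum => z _; case: ifP => [Xc|_]; last first.
  by rewrite mulr_ge0 ?Defs.pmf_ge0 ?sqr_ge0.
by rewrite ler_wpM2l ?Defs.pmf_ge0//; nra.
Qed.

(** * Covariance *)

Definition Cov (R : realType) n (P : design R n) (X Y : assignment n -> R) : R :=
  Ex P (fun z => X z * Y z) - Ex P X * Ex P Y.

Lemma Var_Cov (R : realType) n (P : design R n) X : Var P X = Cov P X X.
Proof.
rewrite /Var /Cov; set m := Ex P X.
rewrite (_ : Ex P _ = Ex P (fun z => X z * X z - 2 * m * X z + m ^+ 2)).
  by rewrite ExD ExB ExZ Ex_cst -/m; ring.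
by apply: eq_Ex => z; ring.
Qed.

Lemma Var_ge0 (R : realType) n (P : design R n) X : 0 <= Var P X.
Proof. by apply: Ex_ge0 => z; exact: sqr_ge0. Qed.

(** Expansion of the nonnegative variance of [X - Y]. *)
Lemma Cov_le_Var (R : realType) n (P : design R n) X Y :
  Cov P X Y <= (Var P X + Var P Y) / 2.
Proof.
have := Var_ge0 P (fun z => X z - Y z).
rewrite !Var_Cov /Cov.
rewrite (_ : Ex P (fun z => (X z - Y z) * (X z - Y z)) =
  Ex P (fun z => X z * X z - 2 * (X z * Y z) + Y z * Y z)).
  rewrite ExB ExD ExB ExZ; nra.
by apply: eq_Ex => z; ring.
Qed.

Lemma Var_mean (R : realType) n (P : design R n) (X : 'I_n -> assignment n -> R) :
  Var P (fun z => n%:R^-1 * \sum_i X i z) =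
  (n%:R ^+ 2)^-1 * \sum_i \sum_j Cov P (X i) (X j).
Proof.
rewrite Var_Cov /Cov.
rewrite (_ : Ex P _ =
  (n%:R ^+ 2)^-1 * \sum_i \sum_j Ex P (fun z => X i z * X j z)); last first.
  rewrite (eq_Ex P (Y := fun z => (n%:R ^+ 2)^-1 * \sum_i \sum_j X i z * X j z)).
    by rewrite ExZ Ex_sum; congr (_ * _); apply: eq_bigr => i _; rewrite Ex_sum.
  by move=> z; rewrite mulrACA -expr2 exprVn big_distrlr.
rewrite ExZ Ex_sum mulrACA -expr2 exprVn big_distrlr -mulrBr /= -sumrB.
by congr (_ * _); apply: eq_bigr => i _; rewrite -sumrB.
Qed.

(** * Independence under a Bernoulli design *)

Definition determined_by n T (A : pred 'I_n) (X : assignment n -> T) : Prop :=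
  forall z z' : assignment n, {in A, z =1 z'} -> X z = X z'.

Definition mix n (A : pred 'I_n) (z z' : assignment n) : assignment n :=
  [ffun i => if A i then z i else z' i].

(* Exchanging the coordinates outside [A] between two independent copies of [Z]
   preserves their joint law, and turns [X(Z) Y(Z')] into [X(Z) Y(Z)]. *)
Lemma Ex_mul_indep (R : realType) n (P : design R n) (A : pred 'I_n) X Y :
  Bernoulli_design P -> determined_by A X -> determined_by (predC A) Y ->
  Ex P (fun z => X z * Y z) = Ex P X * Ex P Y.
Proof.
move=> BP XA YA.
(* At each coordinate the two mixtures carry the values of [z] and [z'] in one order or the other,
   so the product masses have the same factors. *)
have PP z z' : P (mix A z z') * P (mix A z' z) = P z * P z'.
  rewrite !BP -!big_split; apply: eq_bigr => i _; rewrite !ffunE.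
  by case: ifP => // _; exact: mulrC.
rewrite {2 3}/Ex big_distrlr /= pair_big /=.
pose h (p : assignment n * assignment n) := (mix A p.1 p.2, mix A p.2 p.1).
have hK : involutive h.
  by case=> z z'; congr pair; apply/ffunP => i; rewrite !ffunE; case: (A i).
rewrite (reindex_inj (inv_inj hK)) /=.
rewrite (eq_bigr (fun p : assignment n * assignment n =>
  (P p.1 * (X p.1 * Y p.1)) * P p.2)) => [|[z z'] _ /=]; last first.
  rewrite (XA (mix A z z') z) => [|i iA]; last by rewrite ffunE (iA : A i).
  rewrite (YA (mix A z' z) z) => [|i iA]; last first.
    by rewrite ffunE (negbTE (iA : ~~ A i)).
  by rewrite mulrACA PP; ring.
(* Now [z'] enters only through its mass, which sums to 1. *)
rewrite -(pair_big xpredT xpredT (fun z z' => P z * (X z * Y z) * P z')) /=.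
by apply: eq_bigr => z _; rewrite -mulr_sumr pmf_sum1 mulr1.
Qed.

(** Non-interference only concerns a change of one coordinate, so the two assignments are joined by
    a path of such changes. *)
Lemma outcome_determined (R : realType) n (y : outcomes R n) j :
  determined_by (fun l => interferes y l j) (y j).
Proof.
move=> z z' zz'.
(* [zk] moves from [z] to [z'] one coordinate at a time. *)
pose zk k : assignment n := [ffun l : 'I_n => if (l < k)%N then z' l else z l].
have -> : z = zk 0%N by apply/ffunP => l; rewrite ffunE.
have -> : z' = zk n by apply/ffunP => l; rewrite ffunE ltn_ord.
suff H k : (k <= n)%N -> y j (zk 0%N) = y j (zk k) by exact: H.
elim: k => // k IH kn; rewrite IH; last exact: ltnW.
(* If coordinate [k] interferes with [j], then [z] and [z'] agree there and the move is trivial;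
   otherwise the move alters only a coordinate that leaves [y j] unchanged. *)
have [I|NI] := boolP (interferes y (Ordinal kn) j).
  congr (y j _); apply/ffunP => l; rewrite !ffunE ltnS [in RHS]leq_eqVlt.
  case: eqVneq => //= lk; rewrite lk ltnn.
  by have -> : l = Ordinal kn by [apply/val_inj]; rewrite (zz' _ I).
move: NI; rewrite negb_or => /andP[_ /existsPn/(_ (zk k))/existsPn/(_ (zk k.+1))].
rewrite negb_and negbK => /orP[|/eqP//].
have -> : delete (Ordinal kn) (zk k) = delete (Ordinal kn) (zk k.+1).
  apply/ffunP => l; rewrite !ffunE ltnS [in RHS]leq_eqVlt.
  by rewrite eq_sym (negbTE (neq_bump _ _)).
by rewrite eqxx.
Qed.

(** * Inverse probability weighted scores *)

Definition score (R : realType) n (P : design R n) (y : outcomes R n) (i : 'I_n)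
    (z : assignment n) : R :=
  (z i)%:R * y i z / prob1 P i - (1 - (z i)%:R) * y i z / (1 - prob1 P i).

Lemma tau_HT_score (R : realType) n (P : design R n) (y : outcomes R n) z :
  tau_HT P y z = n%:R^-1 * \sum_i score P y i z.
Proof. by rewrite /tau_HT -mulrBr -sumrB. Qed.

(** Since [z i] is 0 or 1, one of the two terms of the score is zero and squaring leaves no cross
    term. *)
Lemma Var_BER_score (R : realType) n (P : design R n) (y : outcomes R n) z :
  Var_BER P y z = (n%:R ^+ 2)^-1 * \sum_i score P y i z ^+ 2.
Proof.
rewrite /Var_BER -mulrDr -big_split; congr (_ * _); apply: eq_bigr => i _.
rewrite /score /= -!exprVn; case: (z i) => /=; ring.
Qed.

(** No unit interferes with both [i] and [j], so the two scores read disjoint sets of coordinates.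
    The function [f] allows both the scores and their squares. *)
Lemma Cov_independent (R : realType) n (P : design R n) (y : outcomes R n)
    (f : R -> R) i j :
  Bernoulli_design P -> ~~ dependent y i j ->
  Cov P (fun z => f (score P y i z)) (fun z => f (score P y j z)) = 0.
Proof.
move=> BP /existsPn ind.
(* Besides the outcome, the score of [l] reads coordinate [l], which [interferes] includes through
   its reflexive clause. *)
have D l : determined_by (fun h => interferes y h l) (score P y l).
  move=> z z' zz'; rewrite /score (outcome_determined zz').
  by rewrite (zz' l)//; apply/orP; left.
rewrite /Cov (Ex_mul_indep BP (A := fun h => interferes y h i)) ?subrr//.
  by move=> z z' zz'; rewrite (D i _ _ zz').
move=> z z' zz'; rewrite (D j z z')// => l lj; apply: zz'.
by have := ind l; rewrite negb_and (lj : interferes y l j) orbF.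
Qed.

(** The weights depend on [z i] alone and [tau] on the other coordinates; by independence the weight
    of each arm contributes its mean, which is 1. *)
Lemma Ex_score (R : realType) n (P : design R n) (y : outcomes R n) i :
  Bernoulli_design P -> 0 < prob1 P i < 1 ->
  Ex P (score P y i) = Ex P (fun z => tau y i (delete i z)).
Proof.
move=> BP /andP[p0 p1].
have yE z : y i z = y_split y i (z i) (delete i z).
  congr (y i _); apply/ffunP => j; rewrite ffunE.
  by case: unliftP => [l ->|->//]; rewrite ffunE.
have pE : Ex P (fun z => (z i)%:R) = prob1 P i.
  rewrite /prob1 /Pr big_mkcond; apply: eq_bigr => z _.
  by case: (z i); rewrite ?mulr1 ?mulr0.
have indep (f : bool -> R) a :
    Ex P (fun z => f (z i) * y_split y i a (delete i z)) =
    Ex P (fun z => f (z i)) * Ex P (fun z => y_split y i a (delete i z)).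
  apply: (Ex_mul_indep BP (A := pred1 i)) => z z' zz'.
    by rewrite (zz' i)// inE.
  congr y_split; apply/ffunP => l; rewrite !ffunE zz'// !inE.
  by rewrite eq_sym neq_lift.
pose f1 (b : bool) : R := (prob1 P i)^-1 * b%:R.
pose f0 (b : bool) : R := (1 - prob1 P i)^-1 * (1 - b%:R).
(* The weight of an arm vanishes off that arm, so the observed outcome may be replaced by the
   potential outcome of the arm. *)
rewrite (eq_Ex P (X := score P y i) (Y := fun z =>
  f1 (z i) * y_split y i true (delete i z)
  - f0 (z i) * y_split y i false (delete i z))); last first.
  by move=> z; rewrite /score /f1 /f0 yE; case: (z i) => /=; ring.
rewrite /tau !ExB (indep f1) (indep f0) /f1 /f0 !ExZ ExB Ex_cst pE.
by field; lra.
Qed.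

(** * Dependency degrees *)

Lemma d_avgE (R : realType) n (y : outcomes R n) :
  d_avg y = n%:R^-1 * \sum_i \sum_j (dependent y i j)%:R.
Proof.
by congr (_ * _); apply: eq_bigr => i _; rewrite /degree natr_sum.
Qed.

Lemma dependent_refl (R : realType) n (y : outcomes R n) i : dependent y i i.
Proof. by apply/existsP; exists i; rewrite /interferes eqxx. Qed.

Lemma dependentC (R : realType) n (y : outcomes R n) i j :
  dependent y i j = dependent y j i.
Proof. by apply: eq_existsb => l; rewrite andbC. Qed.

Lemma degree_gt0 (R : realType) n (y : outcomes R n) i : (0 < degree y i)%N.
Proof. by rewrite /degree (bigD1 i)//= dependent_refl. Qed.

Lemma degree_le_max (R : realType) n (y : outcomes R n) i :
  (degree y i <= d_max y)%N.
Proof. exact: (leq_bigmax (F := degree y)). Qed.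

Lemma d_max_gt0 (R : realType) n (y : outcomes R n) : (0 < n)%N ->
  (0 < d_max y)%N.
Proof.
move=> n0; exact: leq_trans (degree_gt0 y (Ordinal n0)) (degree_le_max _ _).
Qed.

Lemma d_avg_gt0 (R : realType) n (y : outcomes R n) : (0 < n)%N -> 0 < d_avg y.
Proof.
move=> n0; rewrite mulr_gt0 ?invr_gt0 ?ltr0n//.
rewrite (bigD1 (Ordinal n0))//= ltr_pwDl ?ltr0n ?degree_gt0//.
by apply: sumr_ge0 => i _; rewrite ler0n.
Qed.

Lemma tau_MSQ_ge0 (R : realType) n (P : design R n) (y : outcomes R n) :
  0 <= tau_MSQ P y.
Proof.
by rewrite mulr_ge0 ?invr_ge0 ?ler0n// sumr_ge0// => i _; rewrite sqr_ge0.
Qed.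

(** * The mean squared score and the variance bounds *)

Definition mean_sq_score (R : realType) n (P : design R n) (y : outcomes R n)
    (z : assignment n) : R := n%:R^-1 * \sum_i score P y i z ^+ 2.

(** Only dependent pairs contribute, and there are [n * d_avg] of them. Each covariance is at most
    [C], as a product of squares is at most the average of the fourth powers. *)
Lemma Var_mean_sq_score (R : realType) n (P : design R n) (y : outcomes R n)
    (C : R) : (0 < n)%N -> Bernoulli_design P ->
  (forall i, Ex P (fun z => score P y i z ^+ 4) <= C) ->
  Var P (mean_sq_score P y) <= C * d_avg y / n%:R.
Proof.
move=> n0 BP mom; rewrite (Var_mean P (fun i z => score P y i z ^+ 2)).
have -> : C * d_avg y / n%:R =
    (n%:R ^+ 2)^-1 * \sum_i \sum_j C * (dependent y i j)%:R.
  rewrite d_avgE; under [in RHS]eq_bigr do rewrite -mulr_sumr.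
  by rewrite -mulr_sumr; field; rewrite pnatr_eq0 -lt0n.
rewrite ler_wpM2l ?invr_ge0 ?exprn_ge0// ler_sum// => i _; rewrite ler_sum// => j _.
have [_|ind] := boolP (dependent y i j); last first.
  by rewrite (Cov_independent (fun x => x ^+ 2))// mulr0.
have le_C : Ex P (fun z => score P y i z ^+ 2 * score P y j z ^+ 2) <= C.
  apply: (@le_trans _ _ ((Ex P (fun z => score P y i z ^+ 4)
                          + Ex P (fun z => score P y j z ^+ 4)) / 2)).
    rewrite -ExD mulrC -ExZ; apply: Ex_le => z.
    by have := sqr_ge0 (score P y i z ^+ 2 - score P y j z ^+ 2); lra.
  by have := mom i; have := mom j; lra.
have ge0 l : 0 <= Ex P (fun z => score P y l z ^+ 2).
  by apply: Ex_ge0 => z; exact: sqr_ge0.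
by rewrite /Cov mulr1; have := mulr_ge0 (ge0 i) (ge0 j); lra.
Qed.

Lemma Var_tau_HT_le (R : realType) n (P : design R n) (y : outcomes R n) :
  Bernoulli_design P -> (forall i, 0 < prob1 P i < 1) ->
  Var P (tau_HT P y) <=
  (d_max y)%:R / n%:R * (Ex P (mean_sq_score P y) - tau_MSQ P y).
Proof.
move=> BP p01; pose V i := Var P (score P y i).
have -> : Var P (tau_HT P y) = Var P (fun z => n%:R^-1 * \sum_i score P y i z).
  by congr Var; apply/funext => z; exact: tau_HT_score.
rewrite (Var_mean P (score P y)).
(* By [Ex_score], the squared means of the scores are the summands of [tau_MSQ], so the bracket is
   the average of the [V i]. *)
have -> : (d_max y)%:R / n%:R * (Ex P (mean_sq_score P y) - tau_MSQ P y) =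
    (n%:R ^+ 2)^-1 * \sum_i (d_max y)%:R * V i.
  rewrite /mean_sq_score ExZ Ex_sum /tau_MSQ -mulrBr -sumrB -mulr_sumr.
  rewrite (eq_bigr V) => [|i _]; last by rewrite -Ex_score// /V Var_Cov /Cov -expr2.
  by rewrite -exprVn; ring.
rewrite ler_wpM2l ?invr_ge0 ?exprn_ge0//.
apply: (@le_trans _ _ (\sum_i \sum_j (dependent y i j)%:R * ((V i + V j) / 2))).
  rewrite ler_sum// => i _; rewrite ler_sum// => j _.
  have [_|ind] := boolP (dependent y i j); first by rewrite mul1r Cov_le_Var.
  by rewrite (Cov_independent id)// mul0r.
have -> : \sum_i \sum_j (dependent y i j)%:R * ((V i + V j) / 2) =
    \sum_i (degree y i)%:R * V i.
  (* By symmetry of [dependent], summing [V j] over dependent pairs gives the same as summing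
     [V i]. *)
  have E : \sum_i \sum_j (dependent y i j)%:R * V j = \sum_i (degree y i)%:R * V i.
    rewrite exchange_big; apply: eq_bigr => i _; rewrite -mulr_suml natr_sum.
    by under eq_bigr do rewrite dependentC.
  transitivity ((\sum_i (degree y i)%:R * V i
                 + \sum_i \sum_j (dependent y i j)%:R * V j) / 2); last first.
    by rewrite E; field.
  rewrite -big_split mulr_suml; apply: eq_bigr => i _ /=.
  rewrite natr_sum mulr_suml -big_split mulr_suml.
  by apply: eq_bigr => j _ /=; field.
by apply: ler_sum => i _; rewrite ler_wpM2r ?Var_ge0// ler_nat degree_le_max.
Qed.

(** Isolates the centred [mean_sq_score] as the only random term of a lower bound, ready for
    Chebyshev's inequality. *)
Lemma Var_MAX_excess (R : realType) n (P : design R n) (y : outcomes R n) z :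
  (0 < n)%N -> Bernoulli_design P -> (forall i, 0 < prob1 P i < 1) ->
  (d_max y)%:R / d_avg y *
    (mean_sq_score P y z - Ex P (mean_sq_score P y) + tau_MSQ P y) <=
  n%:R * (d_avg y)^-1 * (Var_MAX P y z - Var P (tau_HT P y)).
Proof.
move=> n0 BP p01; have d0 := d_avg_gt0 y n0; have nR0 : 0 < n%:R :> R by rewrite ltr0n.
have -> : Var_MAX P y z = (d_max y)%:R / n%:R * mean_sq_score P y z.
  by rewrite /Var_MAX Var_BER_score /mean_sq_score -exprVn; ring.
have -> : (d_max y)%:R / d_avg y *
    (mean_sq_score P y z - Ex P (mean_sq_score P y) + tau_MSQ P y) =
    n%:R * (d_avg y)^-1 * ((d_max y)%:R / n%:R * mean_sq_score P y z
    - (d_max y)%:R / n%:R * (Ex P (mean_sq_score P y) - tau_MSQ P y)).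
  by field; rewrite !lt0r_neq0.
apply: ler_wpM2l; first by rewrite divr_ge0 ?ltW.
by rewrite lerB// Var_tau_HT_le.
Qed.

Lemma score_moment4 (R : realType) n (P : design R n) (y : outcomes R n) i
    (k q : R) : 0 < k -> 4 <= q -> k^-1 <= prob1 P i <= 1 - k^-1 ->
  Ex P (fun z => `|y i z| `^ q) <= k `^ q ->
  Ex P (fun z => score P y i z ^+ 4) <= k ^+ 4 * (1 + k `^ q).
Proof.
move=> k0 q4 /andP[kp pk] mom.
have ki0 : 0 < k^-1 by rewrite invr_gt0.
have inv_le (p : R) : k^-1 <= p -> (p^-1) ^+ 4 <= k ^+ 4.
  move=> kp'; have p0 : 0 < p by exact: lt_le_trans kp'.
  rewrite lerXn2r ?nnegrE ?invr_ge0 ?(ltW k0) ?(ltW p0)//.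
  by rewrite invf_ple ?posrE.
(* The constant 1 covers outcomes of modulus at most 1; beyond that, powers increase with the
   exponent and [4 <= q]. *)
have y4 z : y i z ^+ 4 <= 1 + `|y i z| `^ q.
  rewrite -[y i z ^+ 4]ger0_norm ?exprn_even_ge0// normrX.
  have [y1|y1] := leP `|y i z| 1.
    by rewrite ler_wpDr ?powR_ge0// exprn_ile1.
  by rewrite ler_wpDl// -powR_mulrn// ler_powR// ltW.
apply: (@le_trans _ _ (Ex P (fun z => k ^+ 4 * (1 + `|y i z| `^ q)))); last first.
  by rewrite ExZ ExD Ex_cst ler_wpM2l ?exprn_ge0 ?(ltW k0)// lerD2l.
apply: Ex_le => z.
apply: (@le_trans _ _ (k ^+ 4 * y i z ^+ 4)); last first.
  by rewrite ler_wpM2l ?exprn_ge0 ?(ltW k0).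
rewrite /score; case: (z i) => /=.
  rewrite subrr !mul0r subr0 mul1r exprMn mulrC ler_wpM2r ?exprn_even_ge0//.
  exact: inv_le.
(* In the control arm the score is negated, which the even power absorbs, and the upper bound on
   [prob1] bounds the weight. *)
rewrite !mul0r sub0r subr0 mul1r exprNn exprMn -signr_odd expr0 mul1r mulrC.
by rewrite ler_wpM2r ?exprn_even_ge0// inv_le// lerBrDr -lerBrDl.
Qed.

(** * Tail bounds and passage to the limit *)

Lemma asymptotically_conservative_cvg0 (R : realType)
    (P : forall n, design R n) (y : forall n, outcomes R n) V :
  (forall eps : R, 0 < eps -> nonconservative_prob P y V eps n @[n --> \oo] --> 0) ->
  asymptotically_conservative P y V.
Proof.
move=> V0; split=> [eps eps0|]; first by apply/cvg_ex; exists 0; exact: V0.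
(* Every inner limit is 0, so the outer function is constantly 0 on the right of 0. *)
apply: cvg_near_cst; near=> eps.
apply/(cvg_lim (@Rhausdorff R))/V0; near: eps; exact: nbhs_right_gt.
Unshelve. all: by end_near. Qed.

Lemma Pr_nonconservative_d_max (R : realType) n (P : design R n)
    (y : outcomes R n) (C eps : R) : (0 < n)%N -> 0 < eps ->
  Bernoulli_design P -> (forall i, 0 < prob1 P i < 1) ->
  (forall i, Ex P (fun z => score P y i z ^+ 4) <= C) ->
  Pr P (fun z => n%:R * (d_avg y)^-1 * (Var_MAX P y z - Var P (tau_HT P y))
                 <= - eps)
  <= C / eps ^+ 2 * ((d_max y)%:R ^+ 2 / (n%:R * d_avg y)).
Proof.
move=> n0 e0 BP p01 mom; have nR0 : 0 < n%:R :> R by rewrite ltr0n.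
have d0 := d_avg_gt0 y n0.
have D0 : 0 < (d_max y)%:R :> R by rewrite ltr0n d_max_gt0.
have c0 : 0 < eps * d_avg y / (d_max y)%:R by rewrite divr_gt0 ?(mulr_gt0 e0 d0).
apply: (le_trans (Pr_le (B := fun z => mean_sq_score P y z
  - Ex P (mean_sq_score P y) <= - (eps * d_avg y / (d_max y)%:R)) _ _)).
  move=> z /(le_trans (Var_MAX_excess y z n0 BP p01)).
  rewrite -ler_pdivlMl ?divr_gt0// invf_div.
  rewrite (_ : _ * - eps = - (eps * d_avg y / (d_max y)%:R)); last by ring.
  (* Here [tau_MSQ] is dropped as nonnegative; [eps] alone supplies the gap. *)
  by apply: le_trans; rewrite lerDl tau_MSQ_ge0.
apply: (le_trans (Chebyshev_lower P _ c0)).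
have -> : C / eps ^+ 2 * ((d_max y)%:R ^+ 2 / (n%:R * d_avg y)) =
    C * d_avg y / n%:R / (eps * d_avg y / (d_max y)%:R) ^+ 2.
  by field; rewrite !lt0r_neq0.
by rewrite ler_wpM2r ?invr_ge0 ?sqr_ge0// Var_mean_sq_score.
Qed.

(** Only the sign of [- eps] matters: the positive factor [d_max / d_avg] cancels, and the gap below
    the mean is [tau_MSQ], at least [c]. Hence the bound is free of [d_max] and [eps]. *)
Lemma Pr_nonconservative_tau_MSQ (R : realType) n (P : design R n)
    (y : outcomes R n) (C c eps : R) : (0 < n)%N -> 0 < eps -> 0 < c ->
  c <= tau_MSQ P y -> Bernoulli_design P -> (forall i, 0 < prob1 P i < 1) ->
  (forall i, Ex P (fun z => score P y i z ^+ 4) <= C) ->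
  Pr P (fun z => n%:R * (d_avg y)^-1 * (Var_MAX P y z - Var P (tau_HT P y))
                 <= - eps)
  <= C / c ^+ 2 * (d_avg y / n%:R).
Proof.
move=> n0 e0 c0 ct BP p01 mom; have d0 := d_avg_gt0 y n0.
have D0 : 0 < (d_max y)%:R :> R by rewrite ltr0n d_max_gt0.
apply: (le_trans (Pr_le (B := fun z => mean_sq_score P y z
  - Ex P (mean_sq_score P y) <= - c) _ _)).
  move=> z /(le_trans (Var_MAX_excess y z n0 BP p01)) exc.
  have : (d_max y)%:R / d_avg y * (mean_sq_score P y z
    - Ex P (mean_sq_score P y) + tau_MSQ P y) < 0.
    by rewrite (le_lt_trans exc)// oppr_lt0.
  by rewrite pmulr_rlt0 ?divr_gt0//; lra.
apply: (le_trans (Chebyshev_lower P _ c0)).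
rewrite (_ : C / c ^+ 2 * _ = C * d_avg y / n%:R / c ^+ 2); last by ring.
by rewrite ler_wpM2r ?invr_ge0 ?sqr_ge0// Var_mean_sq_score.
Qed.

(** The lower limit is the supremum of the tail infima, so some tail infimum is positive and serves
    as [c]. It is finite because it lies below a real term of the sequence. *)
Lemma limn_einf_gt0 (R : realType) (u : nat -> R) :
  (0%:E < limn_einf (fun n => (u n)%:E))%E ->
  exists2 c : R, 0 < c & \forall n \near \oo, c <= u n.
Proof.
rewrite limn_einf_lim (cvg_lim (@ereal_hausdorff R) (@cvg_einfs_sup _ _)) => /ereal_sup_gt[_ [N _ <-]].
move=> einf0.
have le_einf n : (N <= n)%N -> (einfs (fun n => (u n)%:E) N <= (u n)%:E)%E.
  by move=> Nn; apply: ereal_inf_lbound; exists n.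
case E : (einfs _ N) einf0 le_einf => [c||]; last 2 first.
- by move=> _ /(_ N (leqnn N)).
- by [].
rewrite lte_fin => c0 le_einf; exists c => //.
by exists N => // n /= /le_einf; rewrite lee_fin.
Qed.

Lemma regularity_score (R : realType) (P : forall n, design R n)
    (y : forall n, outcomes R n) (k q s : R) :
  regularity_conditions P y k q s -> 4 <= q ->
  (forall n (i : 'I_n), 0 < prob1 (P n) i < 1) /\
  exists2 C, 0 < C & forall n (i : 'I_n),
    Ex (P n) (fun z => score (P n) (y n) i z ^+ 4) <= C.
Proof.
move=> [k0 _ _ reg] q4; split=> [n i|].
  have [/andP[kp pk] _ _] := reg n i.
  have : 0 < k^-1 by rewrite invr_gt0.
  by move=> ?; apply/andP; split; lra.
exists (k ^+ 4 * (1 + k `^ q)) => [|n i].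
  by rewrite mulr_gt0 ?exprn_gt0// ltr_pwDl ?powR_ge0.
by have [kpk mom _] := reg n i; exact: score_moment4.
Qed.

Theorem proposition9 (R : realType)
    (P : forall n : nat, design R n) (y : forall n : nat, outcomes R n)
    (bernoulli : forall n : nat, Bernoulli_design (P n))
    (conditions :
      (exists k q s : R,
        [/\ regularity_conditions P y k q s, 4 <= q &
            (fun n : nat => (d_max (y n))%:R : R^o) =o_\oo
              (fun n : nat => n%:R `^ 2^-1 * d_avg (y n) `^ 2^-1 : R^o)])
      \/
      (exists k q s : R,
        [/\ regularity_conditions P y k q s, 4 <= q,
            (fun n : nat => d_avg (y n) : R^o) =o_\oo
              (fun n : nat => n%:R : R^o) &
            (0%:E < limn_einf (fun n : nat => (tau_MSQ (P n) (y n))%:E))%E])) :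
  asymptotically_conservative P y
    (fun n : nat => Var_MAX (P n) (y n)).
Proof.
apply: asymptotically_conservative_cvg0 => eps eps0.
apply/cvgr0Pnorm_le => delta delta0.
case: conditions => [[k [q [s [reg q4 o_max]]]]|[k [q [s [reg q4 o_avg tau0]]]]].
  have [p01 [C C0 mom]] := regularity_score reg q4.
  (* The square of this ratio, multiplied by [C / eps ^+ 2], is exactly [delta]. *)
  have eta0 : 0 < Num.sqrt (delta * eps ^+ 2 / C).
    by rewrite sqrtr_gt0 divr_gt0 ?mulr_gt0 ?exprn_gt0.
  move/eqoP/(_ _ eta0): o_max => o_max.
  near=> n.
  (* At [n = 0] the average degree is 0 and could not be divided by. *)
  have n0 : (0 < n)%N by near: n; exists 1%N.
  rewrite ger0_norm ?Pr_ge0//.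
  apply: (le_trans (Pr_nonconservative_d_max n0 eps0 (bernoulli n) (p01 n) (mom n))).
  have d0 := d_avg_gt0 (y n) n0.
  have nd0 : 0 < n%:R * d_avg (y n) by rewrite (mulr_gt0 _ d0) ?ltr0n.
  have : `|(d_max (y n))%:R : R^o| <= Num.sqrt (delta * eps ^+ 2 / C)
      * `|n%:R `^ 2^-1 * d_avg (y n) `^ 2^-1 : R^o|.
    by near: n.
  rewrite !ger0_norm ?mulr_ge0 ?powR_ge0//.
  rewrite -powRM ?(ltW d0)// powR12_sqrt ?(ltW nd0)// -sqrtrM; last first.
    by rewrite divr_ge0 ?mulr_ge0 ?(ltW delta0) ?(ltW eps0) ?(ltW C0).
  move=> dmax_le.
  have : (d_max (y n))%:R ^+ 2 <= delta * eps ^+ 2 / C * (n%:R * d_avg (y n)).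
    rewrite -[leRHS]sqr_sqrtr; last first.
      by rewrite mulr_ge0 ?(ltW nd0)// divr_ge0 ?(ltW C0)// mulr_ge0 ?sqr_ge0 ?(ltW delta0).
    by rewrite lerXn2r ?nnegrE ?sqrtr_ge0.
  rewrite -ler_pdivrMr// => le_o.
  apply: (le_trans (ler_wpM2l _ le_o)); first by rewrite divr_ge0 ?sqr_ge0 ?ltW.
  by rewrite le_eqVlt; apply/orP; left; apply/eqP; field; rewrite !lt0r_neq0.
have [p01 [C C0 mom]] := regularity_score reg q4.
have [c c0 c_tau] := limn_einf_gt0 tau0.
(* This ratio, multiplied by [C / c ^+ 2], is exactly [delta]. *)
have eta0 : 0 < delta * c ^+ 2 / C by rewrite divr_gt0 ?mulr_gt0 ?exprn_gt0.
move/eqoP/(_ _ eta0): o_avg => o_avg.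
near=> n.
have n0 : (0 < n)%N by near: n; exists 1%N.
rewrite ger0_norm ?Pr_ge0//.
have ctn : c <= tau_MSQ (P n) (y n) by near: n.
apply: (le_trans
  (Pr_nonconservative_tau_MSQ n0 eps0 c0 ctn (bernoulli n) (p01 n) (mom n))).
have d0 := d_avg_gt0 (y n) n0.
have : `|d_avg (y n) : R^o| <= delta * c ^+ 2 / C * `|n%:R : R^o| by near: n.
rewrite !ger0_norm ?(ltW d0)// -ler_pdivrMr ?ltr0n// => le_o.
apply: (le_trans (ler_wpM2l _ le_o)); first by rewrite divr_ge0 ?sqr_ge0 ?ltW.
by rewrite le_eqVlt; apply/orP; left; apply/eqP; field; rewrite !lt0r_neq0.
Unshelve. all: by end_near. Qed.
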